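(* Fix two distinct parabolic subgroups $P\neq Q$ with $B\subsetneq P\subsetneq G$ and $B\subsetneq Q\subsetneq G$. Let $\mathcal{B}_P=\{\sigma_v\sigma_w : v\in W^P,\ w\in W_P\}$ denote the product basis of $H^*_T(G/B)$ obtained from the equivariant Schubert bases for $H^*_T(G/P)$ and $H^*_T(P/B)$, and let $\mathcal{B}_Q=\{\sigma_v\sigma_w : v\in W^Q,\ w\in W_Q\}$ be defined similarly for $Q$. Then the bases $\mathcal{B}_P$ and $\mathcal{B}_Q$ are distinct.
   Context: $G$ is a complex reductive linear algebraic group, $B$ a fixed Borel subgroup, $T\subseteq B$ the maximal torus, $W$ the Weyl group with simple reflections $s_1,\dots,s_n$ corresponding to the simple roots $\alpha_1,\dots,\alpha_n$, and $\ell$ the length function. For a parabolic subgroup $P\supseteq B$, $W_P\subseteq W$ is the associated subgroup (the Weyl group of $P/B$, generated by the simple reflections it contains), and $W^P$ is the set of minimal-length representatives of the cosets in $W/W_P$. $T$ acts by left multiplication; cohomology has coefficients in $\mathbb{C}$, and $\mathbb{C}[\mathfrak{t}^*]=H^*_T(pt)$ is the polynomial ring (symmetric algebra) on $\mathfrak{t}^*$, containing the roots as degree-one elements. The $T$-fixed points of $G/B$ are identified with $W$. Restriction to fixed points is injective, so $H^*_T(G/B)$ is regarded as a $\mathbb{C}[\mathfrak{t}^*]$-subalgebra of the ring of functions $W\to\mathbb{C}[\mathfrak{t}^*]$ with pointwise operations. It is a free $\mathbb{C}[\mathfrak{t}^*]$-module with basis the equivariant Schubert classes $\{\sigma_w :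 w\in W\}$, given by Billey's formula: for $u\in W$ with any fixed reduced word $u=s_{b_1}\cdots s_{b_{\ell(u)}}$, set $\mathbf{r}(\mathbf{i},u)=s_{b_1}\cdots s_{b_{i-1}}(\alpha_{b_i})$; then $$\sigma_v(u)=\sum \prod_{i=1}^{\ell(v)}\mathbf{r}(\mathbf{j_i},u),$$ where the sum is over all $1\le j_1<\dots<j_{\ell(v)}\le \ell(u)$ such that $s_{b_{j_1}}\cdots s_{b_{j_{\ell(v)}}}$ is a reduced word for $v$. The Schubert bases of $H^*_T(G/P)$ and $H^*_T(P/B)$ are identified with $\{\sigma_v: v\in W^P\}$ and $\{\sigma_w: w\in W_P\}$ inside $H^*_T(G/B)$; products are taken in $H^*_T(G/B)$. Each $\mathcal{B}_P$ is a $\mathbb{C}[\mathfrak{t}^*]$-module basis of $H^*_T(G/B)$. Bases are compared as subsets of $H^*_T(G/B)$.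
   Formalization: The claim fails for G = SL_2×SL_2 with P, Q the two intermediate parabolics (the bases coincide); it is proved assuming that on some simple factor of G, P and Q restrict to distinct parabolics that are not both among the Borel and the whole factor, which is automatic for connected Dynkin diagram. *)

(* Defs.v *)
From mathcomp Require Import all_boot all_order all_algebra.
From mathcomp Require Import boolp classical_sets reals.
From mathcomp Require Import complex mpoly.

Set Implicit Arguments.
Unset Strict Implicit.
Unset Printing Implicit Defensive.

Import GRing.Theory.
Local Open Scope ring_scope.

(* A connected complex reductive group with a maximal torus T of dimension r
   is encoded by its (reduced) root datum: characters of T are columns in Z^r,
   cocharacters are rows, and the perfect pairing is the matrix product. *)
Definition reflection r (a : 'cV[int]_r) (ac : 'rV[int]_r) : 'M[int]_r :=
  1%:M - a *m ac.

Record root_datum (r : nat) := RootDatum {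
  root_seq : seq 'cV[int]_r;
  coroot : 'cV[int]_r -> 'rV[int]_r;  (* only meaningful on roots *)
  coroot_inj : {in root_seq &, injective coroot};
  coroot_root : forall a, a \in root_seq -> coroot a *m a = 2%:M;
  reflection_root : forall a b, a \in root_seq -> b \in root_seq ->
    reflection a (coroot a) *m b \in root_seq;
  reflection_coroot : forall a b, a \in root_seq -> b \in root_seq ->
    coroot b *m reflection a (coroot a) \in map coroot root_seq;
  root_reduced : forall a b (m k : int), a \in root_seq -> b \in root_seq ->
    m != 0 -> m *: a = k *: b -> a = b \/ a = - b
}.

(* A Borel subgroup B containing T is the same as a base of the root system. *)
Record borel r (G : root_datum r) (n : nat) := Borel {
  alpha : 'I_n -> 'cV[int]_r;
  simple_root : forall i, alpha i \in root_seq G;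
  simple_free : forall c : 'I_n -> int,
    \sum_i c i *: alpha i = 0 -> forall i, c i = 0;
  simple_span : forall a, a \in root_seq G -> exists c : 'I_n -> nat,
    a = \sum_i (c i)%:Z *: alpha i \/ a = - \sum_i (c i)%:Z *: alpha i
}.

Section Weyl.
Context (r : nat) (G : root_datum r) (n : nat) (B : borel G n).

Definition simple_reflection (i : 'I_n) : 'M[int]_r :=
  reflection (alpha B i) (coroot G (alpha B i)).

Definition word_mx (b : seq 'I_n) : 'M[int]_r :=
  \big[mulmx/1%:M]_(i <- b) simple_reflection i.

(* The Weyl group, as a group of automorphisms of the character lattice. *)
Definition weyl : Type := {u : 'M[int]_r | exists b, word_mx b = u}.

Lemma weyl_word_ex (u : weyl) :
  exists k, [exists b : k.-tuple 'I_n, word_mx b == sval u].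
Proof.
have [b <-] := svalP u.
by exists (size b); apply/existsP; exists (in_tuple b).
Qed.

Definition ell (u : weyl) : nat := ex_minn (weyl_word_ex u).

Definition reduced_word (b : seq 'I_n) (u : weyl) : bool :=
  (word_mx b == sval u) && (size b == ell u).

(* A parabolic subgroup containing B is given by the set of those i for which
   s_i lies in its Weyl group; B is set0 and G is [set: 'I_n]. *)
Definition weyl_para (P : {set 'I_n}) : set weyl :=
  [set u | exists2 b : seq 'I_n, all (mem P) b & word_mx b = sval u].

Definition min_rep (P : {set 'I_n}) : set weyl :=
  [set v | forall u x : weyl, weyl_para P x -> sval u = sval v *m sval x ->
     (ell v <= ell u)%N].

Definition dynkin_adj : rel 'I_n :=
  fun i j => coroot G (alpha B i) *m alpha B j != 0.

Definition component (i : 'I_n) : {set 'I_n} :=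
  [set j | connect dynkin_adj i j].

(* On some simple factor of G, the parabolics P and Q restrict to distinct
   parabolics which are not merely the Borel subgroup and the whole factor.
   When the Dynkin diagram is connected this says that P and Q are distinct and
   not both trivial. For disconnected diagrams it cannot be dropped: if
   G = SL_2 x SL_2 and P, Q are the two intermediate parabolics, then W^P = W_Q
   and W_P = W^Q, so that the two product bases coincide. *)
Definition differ_on_simple_factor (P Q : {set 'I_n}) : Prop :=
  exists i, let C := component i in
    P :&: C != Q :&: C /\
    ((P :&: C != finset.set0) && (P :&: C != C) || (Q :&: C != finset.set0) && (Q :&: C != C)).

End Weyl.

Section Schubert.
Context (R : realType) (r : nat) (G : root_datum r) (n : nat) (B : borel G n).

(* The symmetric algebra C[t^*], and a character as a degree-one element. *)
Local Notation S := {mpoly R[i][r]}.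

Definition linear_form (x : 'cV[int]_r) : S := \sum_k (x k 0)%:~R *: 'X_k.

(* The positions k in b are numbered from 0. *)
Definition inversion_root (b : seq 'I_n) (k : 'I_(size b)) : 'cV[int]_r :=
  word_mx B (take k b) *m alpha B (tnth (in_tuple b) k).

Definition billey (b : seq 'I_n) (v : weyl B) : S :=
  \sum_(j : (ell v).-tuple 'I_(size b) |
          sorted ltn (map val j) &&
          reduced_word [seq tnth (in_tuple b) k | k <- j] v)
    \prod_(i < ell v) linear_form (inversion_root (tnth j i)).

(* The class sigma_v restricted to the T-fixed points, computed from a choice
   rw of a reduced word for every u. *)
Definition schubert (rw : weyl B -> seq 'I_n) (v : weyl B) : weyl B -> S :=
  fun u => billey (rw u) v.

Definition product_basis (rw : weyl B -> seq 'I_n) (P : {set 'I_n}) :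
    set (weyl B -> S) :=
  [set f | exists v w, [/\ min_rep P v, weyl_para P w &
     f = schubert rw v \* schubert rw w]].

End Schubert.

Arguments product_basis R {r G n B} rw P.

(* Main.v *)
(* For [i \in P] and [j \notin P] adjacent in the Dynkin diagram, the class of
   [s_j s_i] is not in the product basis of [P]. Indeed, if it were
   [sigma_v * sigma_w], then restricting to the fixed point [s_j s_i] leaves only
   [v] among 1, [s_j] and [w] among 1, [s_i]; at the fixed point [s_i s_j] such a
   product is nonzero while the class of [s_j s_i] vanishes. On the other hand
   [s_j s_i] lies in [W^Q] if [i \notin Q], and in [W_Q] if [i, j \in Q], so its
   class is in the product basis of [Q] unless [i \in Q] and [j \notin Q]. It
   remains to find an edge of the diagram that [P] or [Q] separates, but which
   [P] and [Q] do not meet in the same vertices. *)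
Require Import Defs.
From mathcomp Require Import all_boot all_order all_algebra.
From mathcomp Require Import boolp classical_sets reals.
From mathcomp Require Import complex mpoly.
From mathcomp Require Import zify.

Set Implicit Arguments.
Unset Strict Implicit.
Unset Printing Implicit Defensive.

Import Order.TTheory GRing.Theory Num.Theory.
Local Open Scope ring_scope.

(** * Simple reflections and words acting on the character lattice *)

Section Weyl.
Context (r : nat) (G : root_datum r) (n : nat) (B : borel G n).

Local Notation s_ := (simple_reflection B).
Local Notation a_ := (alpha B).
Local Notation W := (weyl B).

Definition pairing (i : 'I_n) (x : 'cV[int]_r) : int :=
  (coroot G (a_ i) *m x) 0 0.

Lemma mul_simple_reflection i x : s_ i *m x = x - pairing i x *: a_ i.
Proof.
rewrite /simple_reflection /reflection mulmxBl mul1mx -mulmxA.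
by rewrite [coroot _ _ *m x]mx11_scalar mul_mx_scalar.
Qed.

Lemma pairingB i x y : pairing i (x - y) = pairing i x - pairing i y.
Proof. by rewrite /pairing mulmxBr !mxE. Qed.

Lemma pairingZ i c x : pairing i (c *: x) = c * pairing i x.
Proof. by rewrite /pairing -scalemxAr mxE. Qed.

Lemma pairing_simple i : pairing i (a_ i) = 2.
Proof. by rewrite /pairing coroot_root ?simple_root // mxE. Qed.

Lemma simple_reflection_simple i : s_ i *m a_ i = - a_ i.
Proof.
rewrite mul_simple_reflection pairing_simple scaler_nat mulr2n.
by rewrite opprD addNKr.
Qed.

Lemma simple_reflectionK i : s_ i *m s_ i = 1%:M.
Proof.
rewrite {2}/simple_reflection /reflection mulmxBr mulmx1 mulmxA.
by rewrite simple_reflection_simple mulNmx opprK subrK.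
Qed.

Lemma word_mx_cons i b : word_mx B (i :: b) = s_ i *m word_mx B b.
Proof. by rewrite /word_mx big_cons. Qed.

Lemma word_mx_nil : word_mx B [::] = 1%:M.
Proof. by rewrite /word_mx big_nil. Qed.

Lemma word_mx_cat b c : word_mx B (b ++ c) = word_mx B b *m word_mx B c.
Proof.
elim: b => [|i b IH] /=; first by rewrite word_mx_nil mul1mx.
by rewrite !word_mx_cons IH mulmxA.
Qed.

Lemma word_mx1 i : word_mx B [:: i] = s_ i.
Proof. by rewrite word_mx_cons word_mx_nil mulmx1. Qed.

Lemma word_mx2 i j : word_mx B [:: i; j] = s_ i *m s_ j.
Proof. by rewrite word_mx_cons word_mx1. Qed.

Lemma word_mx_rev b : word_mx B b *m word_mx B (rev b) = 1%:M.
Proof.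
elim: b => [|i b IH]; first by rewrite word_mx_nil mulmx1.
rewrite rev_cons -cats1 word_mx_cat word_mx1 word_mx_cons mulmxA.
by rewrite -(mulmxA (s_ i)) IH mulmx1 simple_reflectionK.
Qed.

(* Congruence modulo the integer span of the [a_ k] with [k \in P]. *)
Definition eqm (P : {set 'I_n}) (x y : 'cV[int]_r) : Prop :=
  exists2 c : 'I_n -> int,
    forall k, k \notin P -> c k = 0 & x - y = \sum_k c k *: a_ k.

Lemma eqm_refl (P : {set 'I_n}) x : eqm P x x.
Proof.
by exists (fun=> 0) => //; rewrite subrr big1 // => k _; rewrite scale0r.
Qed.

Lemma eqm_sym (P : {set 'I_n}) x y : eqm P x y -> eqm P y x.
Proof.
move=> [c c0 e]; exists (fun k => - c k).
  by move=> k /c0 ->; rewrite oppr0.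
rewrite -opprB e -sumrN; apply: eq_bigr => k _; by rewrite scaleNr.
Qed.

Lemma eqm_trans (P : {set 'I_n}) y x z : eqm P x y -> eqm P y z -> eqm P x z.
Proof.
move=> [c c0 e] [d d0 f]; exists (fun k => c k + d k).
  by move=> k kP; rewrite c0 // d0.
rewrite -(subrK y x) -addrA e f -big_split /=.
by apply: eq_bigr => k _; rewrite scalerDl.
Qed.

Lemma eqm_opp (P : {set 'I_n}) x y : eqm P x y -> eqm P (- x) (- y).
Proof.
move=> [c c0 e]; exists (fun k => - c k).
  by move=> k /c0 ->; rewrite oppr0.
rewrite -opprD e -sumrN; apply: eq_bigr => k _; by rewrite scaleNr.
Qed.

Lemma eqm_sub (P Q : {set 'I_n}) x y : P \subset Q -> eqm P x y -> eqm Q x y.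
Proof.
move=> PQ [c c0 e]; exists c => // k kQ; apply: c0.
by apply: contra kQ; apply: (fintype.subsetP PQ).
Qed.

Lemma eqm_subZ (P : {set 'I_n}) m k x : k \in P -> eqm P (x - m *: a_ k) x.
Proof.
move=> kP; exists (fun l => - m *+ (l == k)).
  by move=> l lP; case: eqP => // lk; rewrite lk kP in lP.
rewrite (bigD1 k) //= eqxx big1 => [|l /negbTE ->]; last by rewrite scale0r.
by rewrite addr0 mulr1n scaleNr addrAC subrr add0r.
Qed.

Lemma eqm_scale_simple (P : {set 'I_n}) m k x :
  eqm P (x + m *: a_ k) x -> k \notin P -> m = 0.
Proof.
move=> [c c0 e] kP; have := c0 _ kP.
have /(_ k) : forall l, c l - m *+ (l == k) = 0.
  apply: (simple_free (b := B)); under eq_bigr do rewrite scalerBl.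
  rewrite sumrB -e (bigD1 k) //= eqxx big1 => [|l /negbTE ->]; last first.
    by rewrite scale0r.
  by rewrite addr0 mulr1n addrAC addrK subrr.
by rewrite eqxx mulr1n => /eqP; rewrite subr_eq0 => /eqP <-.
Qed.

Lemma eqm_opp_simple (P : {set 'I_n}) m k :
  eqm P (m *: a_ k) (- (m *: a_ k)) -> k \notin P -> m = 0.
Proof.
move=> h kP; have : eqm P (- (m *: a_ k) + (m *+ 2) *: a_ k) (- (m *: a_ k)).
  by rewrite -scalerMnl mulr2n addKr.
move=> /eqm_scale_simple /(_ kP); lia.
Qed.

(** Twice [a_ k] would lie in the span for [P], which freeness of the simple roots forbids when [k]
    is outside [P]. This turns matrix identities between words into statements about their letters:
    apply both sides to a simple root that one of them negates. *)
Lemma eqm_simple (P : {set 'I_n}) k : eqm P (a_ k) (- a_ k) -> k \in P.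
Proof.
move=> h; apply/negPn/negP => kP.
by have := @eqm_opp_simple P 1 k; rewrite !scale1r => /(_ h kP).
Qed.

Lemma word_eqm (P : {set 'I_n}) b x :
  all (mem P) b -> eqm P (word_mx B b *m x) x.
Proof.
elim: b => [|i b IH] /=.
  by rewrite word_mx_nil mul1mx => _; apply: eqm_refl.
move=> /andP[iP /IH h]; rewrite word_mx_cons -mulmxA mul_simple_reflection.
by apply: eqm_trans h; apply: eqm_subZ.
Qed.

Lemma simple_reflection_eqm (P : {set 'I_n}) i x :
  i \in P -> eqm P (s_ i *m x) x.
Proof. by move=> iP; rewrite -word_mx1; apply: word_eqm; rewrite /= iP. Qed.

Lemma simple_reflection_neq1 i : s_ i <> 1%:M.
Proof.
move=> e; have := @eqm_simple finset.set0 i.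
rewrite -simple_reflection_simple e mul1mx inE => h.
by have := h (eqm_refl _ _).
Qed.

Lemma simple_reflection_inj : injective s_.
Proof.
move=> i j e; suff : i \in [set j] by move/finset.set1P.
apply: eqm_simple; rewrite -simple_reflection_simple e; apply: eqm_sym.
by apply: simple_reflection_eqm; rewrite inE.
Qed.

Lemma simple_reflection_mulI i x y : s_ i *m x = s_ i *m y -> x = y :> 'M_r.
Proof.
by move=> /(congr1 (mulmx (s_ i))); rewrite !mulmxA simple_reflectionK !mul1mx.
Qed.

Lemma simple_reflection_mulIr i x y : x *m s_ i = y *m s_ i -> x = y :> 'M_r.
Proof.
move=> /(congr1 (mulmx^~ (s_ i))).
by rewrite -!mulmxA simple_reflectionK !mulmx1.
Qed.

(** * Products of two simple reflections *)

Section Rank2.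
Context (i j : 'I_n) (ij : i != j).

Lemma simple_reflection2_neq1 : s_ j *m s_ i <> 1%:M.
Proof.
rewrite -(simple_reflectionK j) => /simple_reflection_mulI.
by move=> /simple_reflection_inj /eqP; apply/negP.
Qed.

Lemma simple_reflection2_eqm x : eqm [set i; j] (s_ j *m s_ i *m x) x.
Proof.
by rewrite -word_mx2; apply: word_eqm; rewrite /= !inE !eqxx orbT.
Qed.

Lemma simple_reflection2_neq_simple a : s_ j *m s_ i <> s_ a.
Proof.
move=> e; have := simple_reflection2_eqm (a_ a).
rewrite e simple_reflection_simple => /eqm_sym /eqm_simple /finset.set2P[] ea.
  move: e; rewrite ea -{2}[s_ i]mul1mx => /simple_reflection_mulIr.
  exact: simple_reflection_neq1.
move: e; rewrite ea -{2}[s_ j]mulmx1 => /simple_reflection_mulI.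
exact: simple_reflection_neq1.
Qed.

Lemma simple_reflection2_inj a b : s_ i *m s_ j <> s_ j *m s_ i ->
  s_ a *m s_ b = s_ j *m s_ i -> a = j /\ b = i.
Proof.
move=> nc e.
have ab : a != b.
  apply/eqP=> eab; apply: simple_reflection2_neq1.
  by rewrite -e eab simple_reflectionK.
(* [s_ a *m s_ b] negates [a_ b] modulo [a_ a], while [s_ j *m s_ i] fixes it modulo [a_ i] and
   [a_ j]. *)
have : b \in [set a; i; j].
  apply: eqm_simple; apply: (@eqm_trans _ (s_ j *m s_ i *m a_ b)).
    apply: eqm_sym; apply: eqm_sub (simple_reflection2_eqm _).
    by apply/fintype.subsetP=> k; rewrite !inE => /orP[] ->; rewrite ?orbT.
  rewrite -e -mulmxA simple_reflection_simple mulmxN; apply: eqm_opp.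
  by apply: simple_reflection_eqm; rewrite !inE eqxx.
rewrite !inE eq_sym (negbTE ab) /= => /orP[] /eqP eb.
  by move: e; rewrite eb => /simple_reflection_mulIr /simple_reflection_inj.
(* With [b = j], [s_ a] is the conjugate of [s_ i] by [s_ j], hence a word in [i] and [j]. *)
have : a \in [set i; j].
  apply: eqm_simple; rewrite -simple_reflection_simple; apply: eqm_sym.
  rewrite eb in e; rewrite -[s_ a]mulmx1 -(simple_reflectionK j) mulmxA e.
  rewrite -word_mx2.
  rewrite -(word_mx1 j) -word_mx_cat; apply: word_eqm.
  by rewrite /= !inE !eqxx !orbT.
case/finset.set2P=> ea; first by case: nc; rewrite -e ea eb.
by rewrite ea eb eqxx in ab.
Qed.

(** Freeness identifies [m] and [l] with two of the coefficients of constant sign supplied by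
    [simple_span]. *)
Lemma root_sign m l : m *: a_ i + l *: a_ j \in root_seq G ->
  (0 <= m) && (0 <= l) || (m <= 0) && (l <= 0).
Proof.
have key (d : 'I_n -> int) : m *: a_ i + l *: a_ j = \sum_k d k *: a_ k ->
    m = d i /\ l = d j.
  move=> e.
  have z k : d k - m *+ (k == i) - l *+ (k == j) = 0.
    move: k; apply: (simple_free (b := B)).
    under eq_bigr do rewrite !scalerBl.
    rewrite !sumrB -e (bigD1 i) //= eqxx big1 => [|k /negbTE ->]; last first.
      by rewrite scale0r.
    rewrite (bigD1 j) //= eqxx big1 => [|k /negbTE ->]; last by rewrite scale0r.
    by rewrite !addr0 !mulr1n -addrA -opprD subrr.
  move: (z i) (z j); rewrite !eqxx (negbTE ij) [j == i]eq_sym (negbTE ij).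
  by split; lia.
move=> /(simple_span B)[c [] e].
  by have [-> ->] := key (fun k => (c k)%:Z) e; lia.
have [] := key (fun k => - (c k)%:Z).
  by rewrite e -sumrN; apply: eq_bigr => k _; rewrite scaleNr.
by move=> -> ->; lia.
Qed.

Lemma simple_reflection_root k x : x \in root_seq G -> s_ k *m x \in root_seq G.
Proof. by move=> xG; apply: reflection_root => //; apply: simple_root. Qed.

(* If [pairing i (a_ j) = 0], the roots [s_ j a_ i] and [s_ i s_ j a_ i] have
   the same coefficient on [a_ j] and opposite ones on [a_ i]. *)
Lemma pairing_eq0 : pairing i (a_ j) = 0 -> pairing j (a_ i) = 0.
Proof.
move=> q0.
have r1 := simple_reflection_root j (simple_root B i).
have r2 := simple_reflection_root i r1.
move: r2 r1; rewrite !mul_simple_reflection.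
rewrite pairingB pairingZ q0 pairing_simple mulr0 subr0.
set p := pairing _ _.
have -> : a_ i - p *: a_ j - 2 *: a_ i = -1 *: a_ i + (- p) *: a_ j.
  by rewrite scaler_nat mulr2n scaleN1r scaleNr opprD addrACA subrr add0r addrC.
have -> : a_ i - p *: a_ j = 1 *: a_ i + (- p) *: a_ j.
  by rewrite scale1r scaleNr.
by move=> /root_sign h1 /root_sign h2; lia.
Qed.

(** If the reflections commute, applying both products to [a_ i] gives
    [- (p *: (s_ i *m a_ j)) = p *: a_ j] with [p] the pairing, so [p *: a_ j] is congruent to its
    negative modulo [a_ i]. *)
Lemma simple_reflection_noncomm : pairing j (a_ i) <> 0 ->
  s_ i *m s_ j <> s_ j *m s_ i.
Proof.
move=> p0 e; apply: p0.
apply: (@eqm_opp_simple [set i] _ j); last by rewrite inE eq_sym.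
set p := pairing _ _.
have := congr1 (mulmx^~ (a_ i)) e.
rewrite -!mulmxA simple_reflection_simple mulmxN.
rewrite [s_ j *m _]mul_simple_reflection -/p mulmxBr simple_reflection_simple.
rewrite opprB -scalemxAr => /(congr1 (fun x => x + a_ i)).
rewrite subrK addrAC addNr add0r => e2.
rewrite -{1}e2; apply: eqm_opp.
by rewrite scalemxAr; apply: simple_reflection_eqm; rewrite inE.
Qed.

End Rank2.

Lemma simple_reflection_weyl_para (P : {set 'I_n}) b k :
  all (mem P) b -> word_mx B b = s_ k -> k \in P.
Proof.
move=> bP e; apply: eqm_simple; rewrite -simple_reflection_simple -e.
by apply: eqm_sym; apply: word_eqm.
Qed.

Lemma simple_reflection2_weyl_para (P : {set 'I_n}) b i j : i \in P ->
  all (mem P) b -> word_mx B b = s_ j *m s_ i -> j \in P.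
Proof.
move=> iP bP e; apply: (simple_reflection_weyl_para (b := b ++ [:: i])).
  by rewrite all_cat bP /= iP.
by rewrite word_mx_cat e word_mx1 -mulmxA simple_reflectionK mulmx1.
Qed.

(** * Lengths, reduced words and minimal coset representatives *)

Definition weyl_of (b : seq 'I_n) : W :=
  exist _ (word_mx B b) (ex_intro _ b erefl).

Lemma reduced_word_ex (u : W) : exists b, reduced_word b u.
Proof.
rewrite /reduced_word /ell; case: ex_minnP => k /existsP[b /eqP e] _.
by exists b; rewrite e eqxx size_tuple eqxx.
Qed.

Lemma ell_le (u : W) b : word_mx B b = sval u -> (ell u <= size b)%N.
Proof.
move=> e; rewrite /ell; case: ex_minnP => k _; apply.
by apply/existsP; exists (in_tuple b); apply/eqP.
Qed.

Lemma ell_weyl_of b : (ell (weyl_of b) <= size b)%N.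
Proof. exact: ell_le. Qed.

Lemma ell1 : ell (weyl_of [::]) = 0%N.
Proof. by apply/eqP; rewrite -leqn0; apply: ell_weyl_of. Qed.

Lemma min_rep1 P : min_rep P (weyl_of [::]).
Proof. by move=> u x _ _; rewrite ell1. Qed.

Lemma weyl_para1 P : weyl_para P (weyl_of [::]).
Proof. by exists [::]. Qed.

(** Dropping a last letter in [P] would give a shorter element of the same coset. *)
Lemma min_rep_rcons (P : {set 'I_n}) (v : W) b i :
  min_rep P v -> reduced_word (rcons b i) v -> i \notin P.
Proof.
move=> hv /andP[/eqP e /eqP s]; apply/negP => iP.
have iP' : weyl_para P (weyl_of [:: i]) by exists [:: i]; rewrite //= iP.
have eb : sval (weyl_of b) = sval v *m sval (weyl_of [:: i]).
  rewrite -e -cats1 word_mx_cat -mulmxA /= !word_mx1 simple_reflectionK.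
  by rewrite mulmx1.
by have := hv _ _ iP' eb; rewrite -s size_rcons ltnNge ell_weyl_of.
Qed.

(** This forces the value of [rw] at [s_j s_i], so Billey's formula can be evaluated there whatever
    reduced words were chosen. *)
Lemma reduced_word2 i j b : i != j -> s_ i *m s_ j <> s_ j *m s_ i ->
  reduced_word b (weyl_of [:: j; i]) -> b = [:: j; i].
Proof.
move=> ij nc /andP[/eqP e /eqP s]; have := ell_weyl_of [:: j; i].
rewrite -s; case: b e {s} => [|a [|c [|//]]] /=; rewrite word_mx2.
- by rewrite word_mx_nil => /esym /(simple_reflection2_neq1 ij).
- by rewrite word_mx1 => /esym /simple_reflection2_neq_simple.
- by rewrite word_mx2 => /(simple_reflection2_inj ij nc)[-> ->].
Qed.

Lemma min_rep2 (Q : {set 'I_n}) i j : i != j -> pairing i (a_ j) <> 0 ->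
  i \notin Q -> min_rep Q (weyl_of [:: j; i]).
Proof.
move=> ij q0 iQ u x [b bQ bx] /= e.
apply: leq_trans (ell_weyl_of _) _; rewrite leqNgt; apply/negP.
have [c /andP[/eqP cu /eqP <-]] := reduced_word_ex u => sc.
have {}e : s_ j *m s_ i = word_mx B c *m word_mx B (rev b).
  by rewrite cu e -bx -mulmxA word_mx_rev mulmx1 word_mx2.
have {bx}yQ y : eqm Q (word_mx B (rev b) *m y) y.
  by apply: word_eqm; rewrite all_rev.
(* [s_ j *m s_ i] negates [a_ i] modulo [a_ j], while the right side of [e] fixes it modulo the
   simple roots indexed by [Q] and by the letters of [c]. *)
have ic : i \in c.
  have : i \in Q :|: (j |: [set k in c]).
    apply: eqm_simple; apply: (@eqm_trans _ (s_ j *m s_ i *m a_ i)).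
      rewrite e -mulmxA; apply: eqm_sym.
      apply: (@eqm_trans _ (word_mx B (rev b) *m a_ i)).
        by apply: word_eqm; apply/allP => k kc; rewrite !inE kc !orbT.
      by apply: eqm_sub (yQ _); apply: finset.subsetUl.
    rewrite -mulmxA simple_reflection_simple mulmxN; apply: eqm_opp.
    by apply: simple_reflection_eqm; rewrite !inE eqxx orbT.
  by rewrite !inE (negbTE iQ) (negbTE ij).
have ec : c = [:: i].
  by case: c sc ic {cu e} => [|k [|//]] //= _; rewrite inE => /eqP ->.
(* The word [rev b] in [Q] now equals [s_i s_j s_i]. It negates [s_ i *m a_ j = a_ j - q *: a_ i],
   yet fixes it modulo [Q]; reducing modulo [a_ j] as well leaves [q *: a_ i] congruent to its
   negative. *)
apply: q0; apply: (@eqm_opp_simple (j |: Q) _ i); last first.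
  by rewrite !inE negb_or ij.
set q := pairing _ _.
have := congr1 (mulmx (s_ i)) e.
rewrite ec word_mx1 [RHS]mulmxA simple_reflectionK mul1mx.
move=> /(congr1 (mulmx^~ (s_ i *m a_ j))).
rewrite -!mulmxA [s_ i *m (s_ i *m _)]mulmxA.
rewrite simple_reflectionK mul1mx simple_reflection_simple mulmxN.
rewrite mul_simple_reflection.
rewrite -/q => ey; have := yQ (a_ j - q *: a_ i); rewrite -ey => h.
have {}h : eqm (j |: Q) (q *: a_ i - a_ j) (a_ j - q *: a_ i).
  by rewrite -opprB; apply: eqm_sub h; apply: finset.subsetUr.
have aj z : eqm (j |: Q) (z - a_ j) z.
  by rewrite -{1}[a_ j]scale1r; apply: eqm_subZ; rewrite !inE eqxx.
apply: eqm_trans (eqm_trans (eqm_sym (aj _)) h) _.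
by rewrite -opprB; apply: eqm_opp; apply: aj.
Qed.

End Weyl.

(** * Vanishing and non-vanishing in Billey's formula *)

Section Schubert.
Context (R : realType) (r : nat) (G : root_datum r) (n : nat) (B : borel G n).

Local Notation s_ := (simple_reflection B).
Local Notation a_ := (alpha B).
Local Notation W := (weyl B).

Lemma linear_form_neq0 (x : 'cV[int]_r) : x != 0 -> linear_form R x != 0.
Proof.
apply: contraNneq => e; apply/eqP/matrixP => k l; rewrite ord1 mxE.
have := congr1 (mcoeff U_(k)) e; rewrite /linear_form raddf_sum mcoeff0 /=.
rewrite (bigD1 k) //= big1 => [|m /negbTE mk]; last first.
  by rewrite mcoeffZ mcoeffXU mk mulr0.
by rewrite mcoeffZ mcoeffXU eqxx mulr1 addr0 => /eqP; rewrite intr_eq0 => /eqP.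
Qed.

Lemma inversion_root_neq0 b (k : 'I_(size b)) : inversion_root B k != 0.
Proof.
apply/eqP => /(congr1 (mulmx (word_mx B (rev (take k b))))).
rewrite /inversion_root mulmxA mulmx0 -{2}(revK (take k b)) word_mx_rev mul1mx.
set i := tnth _ _ => e; have := pairing_simple B i.
by rewrite /pairing e mulmx0 mxE.
Qed.

(** A strictly increasing list is determined by its set of elements, so it is a filter of the
    enumeration. *)
Lemma subseq_index (m : nat) (j : seq 'I_m) :
  sorted ltn (map val j) -> subseq j (enum 'I_m).
Proof.
move=> sj; suff -> : j = [seq k <- enum 'I_m | k \in j] by apply: filter_subseq.
apply: (inj_map val_inj); apply: (@irr_sorted_eq _ ltn) => //.
- exact: ltn_trans.
- exact: ltnn.
- apply: (subseq_sorted ltn_trans) (iota_ltn_sorted 0 m).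
  by rewrite -val_enum_ord; apply: map_subseq; apply: filter_subseq.
- move=> k; apply/mapP/mapP => -[l lj ->]; exists l => //.
    by rewrite mem_filter lj mem_enum.
  by move: lj; rewrite mem_filter => /andP[].
Qed.

Lemma subseq_subword (b : seq 'I_n) (j : seq 'I_(size b)) :
  sorted ltn (map val j) -> subseq [seq tnth (in_tuple b) k | k <- j] b.
Proof.
by move/subseq_index/(map_subseq (tnth (in_tuple b))); rewrite map_tnth_enum.
Qed.

Lemma billey_neq0_subword (b : seq 'I_n) (v : W) : billey R b v != 0 ->
  exists2 a, subseq a b & reduced_word a v.
Proof.
case: (pselect (exists2 a, subseq a b & reduced_word a v)) => // h /eqP[].
rewrite /billey big_pred0 // => j; apply/negP => /andP[sj rj]; apply: h.
exists [seq tnth (in_tuple b) k | k <- j] => //.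
exact: subseq_subword.
Qed.

(** A single summand survives, a product of nonzero linear forms in an integral domain, so nothing
    can cancel. *)
Lemma billey_neq0 (b a : seq 'I_n) (v : W) : uniq b ->
  subseq a b -> reduced_word a v ->
  (forall c, subseq c b -> reduced_word c v -> c = a) -> billey R b v != 0.
Proof.
move=> ub ab av aP.
have /subseqP[m sm am] := ab.
pose t := mask m (enum 'I_(size b)).
have ta : [seq tnth (in_tuple b) k | k <- t] = a.
  by rewrite /t map_mask map_tnth_enum.
have st : size t == ell v.
  by case/andP: av => _ /eqP <-; rewrite -ta size_map.
rewrite /billey (big_pred1 (Tuple st)).
  apply/prodf_neq0 => i _; apply: linear_form_neq0.
  exact: inversion_root_neq0.
move=> j /=; apply/andP/eqP => [[sj rj]|->]; last first.
  rewrite /= ta av; split => //.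
  apply: (subseq_sorted ltn_trans) (iota_ltn_sorted 0 (size b)).
  by rewrite -val_enum_ord; apply/map_subseq/mask_subseq.
(* As [b] has no repeated letter, a subword determines its positions. *)
apply: val_inj => /=; apply: (@inj_map _ _ (tnth (in_tuple b))).
  by apply/tuple_uniqP.
by rewrite ta; apply: aP => //; apply: subseq_subword.
Qed.

Lemma subseq2 (T : eqType) (x y : T) c : subseq c [:: x; y] ->
  [\/ c = [::], c = [:: x], c = [:: y] | c = [:: x; y]].
Proof.
case/subseqP=> [[|[] [|[] []]]] //= _ ->.
- by constructor 4.
- by constructor 2.
- by constructor 3.
- by constructor 1.
Qed.

Lemma billey2_neq0 x y a (v : W) : x != y -> subseq a [:: x; y] ->
  reduced_word a v -> billey R [:: x; y] v != 0.
Proof.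
move=> xy ab av; apply: (billey_neq0 _ ab av); first by rewrite /= inE xy.
move=> c cb /andP[/eqP ec /eqP sc]; case/andP: (av) => /eqP ea /eqP sa.
move: (ec) (sc); rewrite -ea -sa.
case: (subseq2 cb) => ->; case: (subseq2 ab) => -> //.
all: by rewrite !word_mx1 => /simple_reflection_inj ->.
Qed.

Lemma billey1 b : billey R b (weyl_of B [::]) = 1.
Proof.
have := ell1 B; rewrite /billey /reduced_word; move: (ell _) => k ->.
rewrite (big_pred1 [tuple]) ?big_ord0 // => j.
by rewrite tuple0 /= eqxx.
Qed.

(** * Schubert classes inside and outside a product basis *)

Lemma product_basis_min_rep rw P (v : W) : min_rep P v ->
  product_basis R rw P (schubert R rw v).
Proof.
move=> hv; exists v, (weyl_of B [::]); split => //; first exact: weyl_para1.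
by apply/funext => u; rewrite /= /schubert billey1 mulr1.
Qed.

Lemma product_basis_weyl_para rw P (w : W) : weyl_para P w ->
  product_basis R rw P (schubert R rw w).
Proof.
move=> hw; exists (weyl_of B [::]), w; split => //; first exact: min_rep1.
by apply/funext => u; rewrite /= /schubert billey1 mul1r.
Qed.

Lemma schubert2_notin_product_basis rw (P : {set 'I_n}) i j :
    (forall u : W, reduced_word (rw u) u) -> i \in P -> j \notin P ->
    pairing B i (a_ j) <> 0 -> pairing B j (a_ i) <> 0 ->
  ~ product_basis R rw P (schubert R rw (weyl_of B [:: j; i])).
Proof.
move=> rwP iP jP q0 p0 [v [w [vP [c cP cw] e]]].
have ij : i != j by apply: contraNneq jP => <-.
have nc := simple_reflection_noncomm ij p0.
have nc' : s_ j *m s_ i <> s_ i *m s_ j by move/esym.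
have ji : j != i by rewrite eq_sym.
have rw0 := reduced_word2 ij nc (rwP _).
have rw1 := reduced_word2 ji nc' (rwP _).
have := congr1 (fun f => f (weyl_of B [:: j; i])) e.
rewrite /= /schubert rw0 => e0.
have : billey R [:: j; i] v * billey R [:: j; i] w != 0.
  rewrite -e0; apply: (@billey2_neq0 _ _ [:: j; i]) => //.
  by have := rwP (weyl_of B [:: j; i]); rewrite rw0.
rewrite mulf_eq0 negb_or => /andP[/billey_neq0_subword[a ab av]].
move=> /billey_neq0_subword[d db dw].
(* A reduced word of [v] cannot end in [i], which leaves the empty word and [[:: j]]; both are also
   subwords of [[:: i; j]]. *)
have ai : subseq a [:: i; j].
  case: (subseq2 ab) av => -> av; rewrite ?sub0seq //=.
  - by rewrite (negbTE ji) eqxx.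
  - by have := min_rep_rcons (b := [::]) vP av; rewrite iP.
  - by have := min_rep_rcons (b := [:: j]) vP av; rewrite iP.
(* Since [w] lies in the Weyl group of [P] and [j] is not in [P], [d] is empty or [[:: i]]. *)
have di : subseq d [:: i; j].
  case: (subseq2 db) dw => -> /andP[/eqP]; rewrite ?sub0seq //= -cw => h _.
  - case/negP: jP; apply: (@simple_reflection_weyl_para _ _ _ B _ _ _ cP).
    by rewrite -h word_mx1.
  - by rewrite eqxx.
  - case/negP: jP; apply: (@simple_reflection2_weyl_para _ _ _ B _ _ _ _ iP cP).
    by rewrite -h word_mx2.
have := congr1 (fun f => f (weyl_of B [:: i; j])) e.
rewrite /= /schubert rw1 => e1.
(* At [s_i s_j] the product is thus nonzero, but [[:: j; i]] is not a subword of [[:: i; j]]. *)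
have : billey R [:: i; j] v * billey R [:: i; j] w != 0.
  by apply: mulf_neq0; [exact: billey2_neq0 ai av|exact: billey2_neq0 di dw].
rewrite -e1 => /billey_neq0_subword[f fs fr]; move: fs.
by rewrite (reduced_word2 ij nc fr) /= (negbTE ji) eqxx.
Qed.

(** The implication excludes the case where [Q], like [P], contains [i] but not [j]; in all others
    the class of [s_j s_i] tells the bases apart. *)
Lemma product_basis_neq rw (P Q : {set 'I_n}) i j :
    (forall u : W, reduced_word (rw u) u) -> i \in P -> j \notin P ->
    (i \in Q -> j \in Q) ->
    pairing B i (a_ j) <> 0 -> pairing B j (a_ i) <> 0 ->
  product_basis R rw P <> product_basis R rw Q.
Proof.
move=> rwP iP jP ijQ q0 p0 e.
apply: (schubert2_notin_product_basis rwP iP jP q0 p0); rewrite e.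
have ij : i != j by apply: contraNneq jP => <-.
have [iQ|iQ] := boolP (i \in Q); last by apply/product_basis_min_rep/min_rep2.
by apply: product_basis_weyl_para; exists [:: j; i]; rewrite //= iQ ijQ.
Qed.

End Schubert.

(** * Edges of the Dynkin diagram separated by a parabolic *)

Lemma connect_change (T : finType) (U : eqType) (e : rel T) (f : T -> U) x y :
  connect e x y -> f x != f y ->
  exists p q, [/\ connect e x p, e p q, f p = f x & f q != f x].
Proof.
move=> /connectP[s]; elim/last_ind: s y => [y _ ->|s z IH y].
  by rewrite eqxx.
rewrite rcons_path last_rcons => /andP[ps ez] -> fz.
(* If [f] still has its initial value at the last vertex but one, the final edge is the one sought;
   otherwise the path is shortened. *)
have [fs|fs] := eqVneq (f x) (f (last x s)); last exact: IH ps erefl fs.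
exists (last x s), z; split => //; last by rewrite eq_sym.
by apply/connectP; exists s.
Qed.

(* Walking from [x] to a vertex where "[P] and [Q] agree" changes, or else, if
   they disagree throughout, to a vertex where membership in [P] changes. *)
Lemma separating_edge r (G : root_datum r) n (B : borel G n) (P Q : {set 'I_n}) :
  differ_on_simple_factor B P Q ->
  exists p q, [/\ dynkin_adj B p q,
    (p \in P) != (q \in P) \/ (p \in Q) != (q \in Q) &
    ~ ((p \in P) = (p \in Q) /\ (q \in P) = (q \in Q))].
Proof.
move=> [x []].
set C := component B x => PQ nt.
have mC y : (y \in C) = connect (dynkin_adj B) x y by rewrite inE.
have [y yC yPQ] : exists2 y, y \in C & (y \in P) != (y \in Q).
  apply: contrapT => h; case/negP: PQ; apply/eqP/setP => y.
  rewrite !finset.in_setI; case: (boolP (y \in C)) => [yC|_].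
    rewrite !andbT; apply/eqP/negPn/negP => hy; apply: h; by exists y.
  by rewrite !andbF.
pose f z := (z \in P) == (z \in Q).
have [z /andP[zC zf]|hz] := pickP (fun z => (z \in C) && (f z != f x)).
  rewrite eq_sym in zf; rewrite mC in zC.
  have [p [q [_ pq fp fq]]] := connect_change zC zf.
  move: fq; rewrite -fp /f => fq; exists p, q; split => //; last first.
    by move=> [ep eq]; rewrite ep eq !eqxx in fq.
  (* Where agreement changes along an edge, exactly one of the two memberships changes. *)
  by move: fq; do 4!case: (_ \in _) => //=; auto.
(* Agreement is constant on [C] and fails at [y], so [P] and [Q] are complementary within [C]. *)
have fC z : z \in C -> f z = false.
  move=> zC; have := hz z; have := hz y; rewrite zC yC /=.
  move=> /negbFE/eqP fy /negbFE/eqP ->.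
  by rewrite -fy /f; apply/negbTE.
(* If membership in [P] were constant on [C], one of [P], [Q] would contain [C] and the other miss
   it, against [nt]. *)
have [z zC zP] : exists2 z, z \in C & (x \in P) != (z \in P).
  apply: contrapT => h.
  have hP z : z \in C -> (z \in P) = (x \in P).
    move=> zC; apply/eqP; rewrite eq_sym; apply/negPn/negP => hh; apply: h.
    by exists z.
  have hQ z : z \in C -> (z \in Q) = ~~ (x \in P).
    move=> zC; have := fC z zC; rewrite /f hP //; by do 2?case: (_ \in _).
  have {}hP : P :&: C = if x \in P then C else finset.set0.
    apply/setP => z; rewrite finset.in_setI; case: (boolP (z \in C)) => zC.
      by rewrite andbT hP //; case: ifP; rewrite ?zC ?finset.in_set0.
    by rewrite andbF; case: ifP; rewrite ?(negbTE zC) ?finset.in_set0.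
  have {}hQ : Q :&: C = if x \in P then finset.set0 else C.
    apply/setP => z; rewrite finset.in_setI; case: (boolP (z \in C)) => zC.
      by rewrite andbT hQ //; case: ifP; rewrite ?zC ?finset.in_set0.
    by rewrite andbF; case: ifP; rewrite ?(negbTE zC) ?finset.in_set0.
  by move: nt; rewrite hP hQ; case: ifP => _; rewrite !eqxx ?andbF.
rewrite mC in zC.
have [p [q [pC pq fp fq]]] := connect_change (f := fun z => z \in P) zC zP.
rewrite -mC in pC.
exists p, q; split => //; first by left; rewrite fp eq_sym.
by move=> [/eqP]; rewrite -/(f p) fC.
Qed.

Theorem theorem1p2 (R : realType) (r n : nat) (G : root_datum r)
    (B : borel G n) (rw : weyl B -> seq 'I_n)
    (rw_reduced : forall u : weyl B, reduced_word (rw u) u)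
    (P Q : {set 'I_n})
    (PQ : P != Q)
    (BP : P != finset.set0) (PG : P != [set: 'I_n])
    (BQ : Q != finset.set0) (QG : Q != [set: 'I_n])
    (PQ_factor : differ_on_simple_factor B P Q) :
  product_basis R rw P <> product_basis R rw Q.
Proof.
have [p [q [pq cross npq]]] := separating_edge PQ_factor.
have q0 : pairing B p (alpha B q) <> 0.
  move=> h; case/negP: pq; apply/eqP/matrixP => k l.
  by rewrite !ord1 [RHS]mxE.
have neq : p != q.
  by apply/eqP => e; case: cross; rewrite e eqxx.
have p0 : pairing B q (alpha B p) <> 0.
  by move=> h; apply: q0; apply: pairing_eq0 h; rewrite eq_sym.
(* The endpoint lying in [P1] plays the role of [i]; the second hypothesis prevents [Q1] from
   containing this endpoint and missing the other. *)
have main (P1 Q1 : {set 'I_n}) : (p \in P1) != (q \in P1) ->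
    ~ ((p \in P1) = (p \in Q1) /\ (q \in P1) = (q \in Q1)) ->
    product_basis R rw P1 <> product_basis R rw Q1.
  case: (boolP (p \in P1)) => pP; case: (boolP (q \in P1)) => qP //= _ h.
    apply: (product_basis_neq rw_reduced pP qP _ q0 p0) => pQ.
    by apply/negPn/negP => qQ; apply: h; rewrite pQ (negbTE qQ).
  apply: (product_basis_neq rw_reduced qP pP _ p0 q0) => qQ.
  by apply/negPn/negP => pQ; apply: h; rewrite qQ (negbTE pQ).
case: cross => c; first exact: main c npq.
by move=> /esym; apply: main c _ => -[e1 e2]; apply: npq.
Qed.
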